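(* Let $q$ be a prime power and $m\geq 1$. Let $M(x)=x^{2m}+c_{2m-1}x^{2m-1}+\cdots+c_1x+1\in\mathbb{F}_q[x]$ be a monic self-reciprocal polynomial of degree $2m$ with $M(0)=1$ (so $c_i=c_{2m-i}$ for all $i$, with $c_0=c_{2m}=1$). Suppose that $x-1$ divides $M(x)$ with multiplicity exactly two, and that $M_1(x)=M(x)/(x-1)^2$ has no factor equal to $x\pm 1$ and all its irreducible factors have multiplicity one. Define \[\Phi(x)=x^{q^{2m}}+c_{2m-1}x^{q^{2m-1}}+\cdots+c_1x^q+x\in\mathbb{F}_q[x],\qquad L(x)=\Phi(x)+tx^{q^m}\in\mathbb{F}_q(t)[x],\] and let $G$ be the Galois group of $L(x)$ over $\mathbb{F}_q(t)$, acting on the $2m$-dimensional $\mathbb{F}_q$-space $V$ of roots of $L$. Then there is a prime ideal of degree $1$ in $\mathbb{F}_q[t]$ whose corresponding Frobenius class in $G$ contains an element a power of which acts on $V$ as a symplectic transvection (with respect to a $G$-invariant nondegenerate alternating bilinear form on $V$).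
   Context: A monic polynomial $g\in\mathbb{F}_q[x]$ of degree $d$ with $g(0)\neq0$ is self-reciprocal if $g(x)=x^dg(0)^{-1}g(x^{-1})$. For a $q$-polynomial $L$ over $\mathbb{F}_q(t)$ with nonzero $x$-coefficient, the roots in a splitting field $E$ form an $\mathbb{F}_q$-vector space $V$ of dimension equal to the $q$-degree, and the Galois group $G$ acts $\mathbb{F}_q$-linearly on $V$. Since $\Phi$ (hence $L$) is $q$-palindromic, there is a nondegenerate alternating bilinear form on $V$ invariant under $G$. Frobenius class: for $\mu\in\mathbb{F}_q$, let $I=(t-\mu)\subset\mathbb{F}_q[t]$ (a prime ideal of degree 1), let $R$ be the integral closure of $\mathbb{F}_q[t]$ in $E$, $J$ a prime of $R$ over $I$, and $D\le G$ the decomposition group of $J$. When the reduction of $L$ mod $I$ has nonzero $x$-coefficient, $D$ is cyclic, generated by an element $\sigma$ with $\sigma(z)\equiv z^q \pmod J$ for all $z\in R$; the $G$-conjugacy class of such $\sigma$ (over all choices of $J$) is the Frobenius class of $I$. A symplectic transvection is an element $\sigma$ of the symplectic group with minimal polynomial $(x-1)^2$ such that $\sigma-I$ has rank one. *)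

(* Defs.v *)
From HB Require Import structures.
From mathcomp Require Import all_boot all_order all_algebra all_fingroup all_field.
Set Implicit Arguments. Unset Strict Implicit. Unset Printing Implicit Defensive.
Import GRing.Theory.
Local Open Scope ring_scope.

Notation ratfun F := {fraction {poly F}}.
Notation "x %:F" := (@FracField.tofrac _ x) (format "x %:F").

Definition tvar (F : fieldType) : ratfun F := ('X : {poly F})%:F.

(* Self-reciprocal monic polynomial: g(0) <> 0 and g(x) = x^d g(0)^-1 g(1/x),
   i.e. coefficientwise g_j = g_0^-1 g_(d-j) for j <= d, d = deg g. *)
Definition self_reciprocal (F : fieldType) (g : {poly F}) : Prop :=
  g \is monic /\ g`_0 != 0 /\
  forall j, (j <= (size g).-1)%N -> g`_j = (g`_0)^-1 * g`_((size g).-1 - j).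

Definition qassoc (F : finFieldType) (M : {poly F}) : {poly ratfun F} :=
  \sum_(i < size M) ((M`_i)%:P%:F)%:P * 'X^(#|F| ^ i).

Definition Lpoly (F : finFieldType) (M : {poly F}) (m : nat) : {poly ratfun F} :=
  qassoc M + (tvar F)%:P * 'X^(#|F| ^ m).

Section Ext.
Variables (F : finFieldType) (E : fieldExtType (ratfun F)).

Definition inE_pol (f : {poly F}) : E := (f%:F)%:A.
Definition inE (a : F) : E := inE_pol a%:P.

Definition integralFt (z : E) : Prop :=
  exists2 p : {poly {poly F}}, p \is monic & root (map_poly inE_pol p) z.

Definition prime_ideal_R (J : E -> Prop) : Prop :=
  (forall z, J z -> integralFt z) /\
  [/\ J 0,
      forall a b, J a -> J b -> J (a + b),
      forall r a, integralFt r -> J a -> J (r * a),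
      ~ J 1 &
      forall a b, integralFt a -> integralFt b -> J (a * b) -> J a \/ J b].

Definition lies_over (J : E -> Prop) (mu : F) : Prop :=
  forall f : {poly F}, J (inE_pol f) <-> ('X - mu%:P) %| f.
End Ext.

Section Gal.
Variables (F : finFieldType) (E : splittingFieldType (ratfun F)).

Definition in_decomp (J : E -> Prop) (g : gal_of {:E}) : Prop :=
  g \in 'Gal(fullv / 1%AS)%g /\
  (forall z, J z -> J (g z)) /\ (forall z, J z -> exists2 w, J w & g w = z).

Definition frobenius_at (J : E -> Prop) (s : gal_of {:E}) : Prop :=
  in_decomp J s /\
  (forall g, in_decomp J g <-> exists n, g = (s ^+ n)%g) /\
  (forall z, integralFt z -> J (s z - z ^+ #|F|)).

Definition rootsV (L : {poly ratfun F}) (x : E) : Prop :=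
  root (map_poly (in_alg E) L) x.

Definition invariant_symplectic_form (L : {poly ratfun F}) (B : E -> E -> F) : Prop :=
  [/\ forall a x y z, rootsV L x -> rootsV L y -> rootsV L z ->
        B (inE E a * x + y) z = a * B x z + B y z,
      forall a x y z, rootsV L x -> rootsV L y -> rootsV L z ->
        B z (inE E a * x + y) = a * B z x + B z y,
      forall x, rootsV L x -> B x x = 0,
      forall x, rootsV L x -> (forall y, rootsV L y -> B x y = 0) -> x = 0 &
      forall g x y, g \in 'Gal(fullv / 1%AS)%g -> rootsV L x -> rootsV L y ->
        B (g x) (g y) = B x y].

(* tau (in G, hence preserving B) acts on V as a symplectic transvection:
   minimal polynomial (x-1)^2 and tau - 1 of rank one on V. *)
Definition transvection_on (L : {poly ratfun F}) (tau : gal_of {:E}) : Prop :=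
  (forall x, rootsV L x -> tau (tau x) - 2%:R * tau x + x = 0) /\
  (exists x, rootsV L x /\ tau x != x) /\
  (exists2 v : E, v != 0 &
     forall x, rootsV L x -> exists a : F, tau x - x = inE E a * v).
End Gal.

(* Main.v *)
Require Import Defs.
From HB Require Import structures.
From mathcomp Require Import all_boot all_order all_algebra all_fingroup all_field.
From mathcomp Require Import boolp zify.
From mathcomp Require classical_sets.
Import GRing.Theory.
Set Implicit Arguments. Unset Strict Implicit. Unset Printing Implicit Defensive.
Local Open Scope ring_scope.

(** Write [R] for the integral closure of [F[t]] in [E] and [V] for the roots of
    [L]. Take [mu = 0] and a maximal ideal [J] of [R] containing [t].

    Since [L = x + O(x^2)] over [R], a nonzero root of [L] is never in [J], so [V]
    embeds in [R/J] and an automorphism is determined by its action on [V] modulo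
    [J]. Existence of the Frobenius element [s], and the fact that it generates
    the decomposition group, both come from one statement: if a ring endomorphism
    [psi] fixes modulo [J] the [H]-invariant elements of [R], then on any finite
    subset of [R] it agrees modulo [J] with some element of [H].

    As [L = Phi] modulo [t], [M] annihilates [s] on [V], and counting roots in
    [R/J] shows that the annihilator of [s] is exactly [(M)]. If [r] is the prime
    to [p] part of the order of [s], then [M1] divides [X^r - 1] because it is
    squarefree, whereas [(X - 1)^2] does not because [r <> 0] in [F]. Hence
    [s^r - 1] is nonzero on [V], has square zero, and has its image in
    [ker (s - 1)], which is a line because its residues lie in [F].

    The symplectic form is the bilinear concomitant of the self-adjoint operator
    [L]: an explicit [Q] with
    [Q(x,y)^q - Q(x,y) = y^(q^m) L(x) - x^(q^m) L(y)], which is thus [F]-valued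
    on [V]; it is nondegenerate because [Q(x, .)] has degree [q^(2m-1)] while [V]
    has [q^(2m)] elements. *)

(* The name [inE] itself refers to the MathComp rewriting rule. *)
Local Notation constE := Defs.inE.

(** * Constants, the [q]-power map and the integral closure of [F[t]] in [E] *)

Section Constants.
Variables (F : finFieldType) (E : fieldExtType (ratfun F)).

HB.instance Definition _ := GRing.RMorphism.copy (inE_pol E)
  (in_alg E \o @FracField.tofrac {poly F}).
HB.instance Definition _ := GRing.RMorphism.copy (constE E)
  (inE_pol E \o polyC).

Lemma inE_pol_inj : injective (inE_pol E).
Proof.
by move=> f g /(@fmorph_inj _ _ (in_alg E))/eqP; rewrite tofrac_eq => /eqP.
Qed.

Lemma pchar_natE p : p \in [pchar F] -> p \in [pchar E].
Proof. exact: rmorph_pchar (constE E) p. Qed.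

Lemma pnat_card_pchar : [pchar E].-nat #|F|.
Proof.
have [p p_pr pF] := finPcharP F.
rewrite (eq_pnat _ (pcharf_eq (pchar_natE pF))) -[#|F|]/#|pPrimeCharType pF|.
by rewrite card_pprimeChar pnatX pnat_id.
Qed.

(** Made a ring endomorphism of [E] below, so that it can serve as [psi] in
    [simultaneous_conjugate]. *)
Definition frobE (x : E) : E := x ^+ #|F|.

Fact frobE_zmod_morphism : zmod_morphism frobE.
Proof.
move=> x y; rewrite /frobE (exprDn_pchar _ _ pnat_card_pchar).
by rewrite (exprNn_pchar _ pnat_card_pchar).
Qed.

Fact frobE_monoid_morphism : monoid_morphism frobE.
Proof. by split=> [|x y]; rewrite /frobE ?expr1n ?exprMn. Qed.

HB.instance Definition _ := GRing.isZmodMorphism.Build E E frobE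
  frobE_zmod_morphism.
HB.instance Definition _ := GRing.isMonoidMorphism.Build E E frobE
  frobE_monoid_morphism.

Lemma frobE_const a : frobE (constE E a) = constE E a.
Proof. by rewrite /frobE -rmorphXn expf_card. Qed.

Lemma expX_card n (x : E) : x ^+ (#|F| ^ n) = iter n frobE x.
Proof. by elim: n => [|n IHn] //=; rewrite -IHn expnSr exprM. Qed.

(** Evaluation at [x] of the factorization of [X^q - X] over [F]. It identifies the fixed points of
    [frobE] and, modulo a prime, the residues fixed by Frobenius. *)
Lemma frobE_sub_prod (x : E) : frobE x - x = \prod_(a : F) (x - constE E a).
Proof.
have /(congr1 (horner^~ x \o map_poly (constE E))) /= := finField_genPoly F.
rewrite rmorphB rmorph_prod /= map_polyXn map_polyX !hornerE horner_prod => ->.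
by apply: eq_bigr => a _; rewrite rmorphB /= map_polyX map_polyC !hornerE.
Qed.

Lemma frobE_fixed (x : E) : frobE x = x -> exists a, x = constE E a.
Proof.
move=> fx; have /eqP := frobE_sub_prod x.
rewrite fx subrr eq_sym prodf_seq_eq0 => /hasP[a _ /=].
by rewrite subr_eq0 => /eqP ->; exists a.
Qed.

(** A boolean version of [integralFt], so that closure as a subring can be registered and the
    [rpred] lemmas apply. *)
Definition integral_pred : {pred E} := fun z => `[< integralFt z >].

Lemma integral_predP z : reflect (integralFt z) (z \in integral_pred).
Proof. exact: asboolP. Qed.

Fact integral_subring_closed : subring_closed integral_pred.
Proof.
by split=> [|x y /integral_predP Rx /integral_predP Ry|
  x y /integral_predP Rx /integral_predP Ry]; apply/integral_predP;
  [exact: (integral1 (inE_pol E)) | exact: (integral_sub (RtoK := inE_pol E)) |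
   exact: (integral_mul (RtoK := inE_pol E))].
Qed.
HB.instance Definition _ := GRing.isSubringClosed.Build E integral_pred
  integral_subring_closed.

Lemma integral_inE_pol f : inE_pol E f \in integral_pred.
Proof. by apply/integral_predP; exact: (integral_id (inE_pol E)). Qed.

Lemma integral_const a : constE E a \in integral_pred.
Proof. exact: integral_inE_pol. Qed.

Lemma frobE_integral z : z \in integral_pred -> frobE z \in integral_pred.
Proof. by move=> Rz; rewrite rpredX. Qed.

Lemma scalar_ratio (c : ratfun F) :
  exists a b : {poly F}, b != 0 /\ inE_pol E b * c%:A = inE_pol E a.
Proof.
elim/quotW: c => x; exists (\n_x), (\d_x); split; first exact: denom_ratioP.
rewrite /inE_pol -(rmorphM (in_alg E)) /=; congr (_%:A).
unlock FracField.tofrac; rewrite -[LHS]FracField.pi_mul; apply/eqmodP => /=.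
have d0 := denom_ratioP x; rewrite /FracField.mulf /FracField.equivf.
by rewrite !numden_Ratio ?mul1r ?mulr1 ?oner_neq0 // mulrC.
Qed.

End Constants.
Arguments integral_pred {F} E _.
Arguments frobE {F} E x.

(** * Prime ideals relative to a subring *)

(** Stated relative to a subset [S] of an ambient domain, so that it covers both the integral
    closure inside [E] and the polynomials over it, without forming a quotient ring. *)
Record prime_in (Z : idomainType) (S : {pred Z}) (I : Z -> Prop) : Prop :=
  PrimeIn {
    prime_in0 : I 0;
    prime_inD : forall a b, I a -> I b -> I (a + b);
    prime_inM : forall r a, r \in S -> I a -> I (r * a);
    prime_in1 : ~ I 1;
    prime_inP : forall a b, a \in S -> b \in S -> I (a * b) -> I a \/ I b }.

Section PrimeIdeals.
Variables (Z : idomainType) (S : subringClosed Z).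
Variables (I : Z -> Prop) (pI : prime_in S I).

Lemma prime_inN a : I a -> I (- a).
Proof. by rewrite -mulN1r; apply: (prime_inM pI); rewrite ?rpredN1. Qed.

Lemma prime_inB a b : I a -> I b -> I (a - b).
Proof. by move=> Ia /prime_inN; apply: (prime_inD pI). Qed.

Lemma prime_inBC a b : I (a - b) -> I (b - a).
Proof. by move=> /prime_inN; rewrite opprB. Qed.

Lemma prime_in_trans b a c : I (a - b) -> I (b - c) -> I (a - c).
Proof. by move=> Iab /(prime_inD pI Iab); rewrite addrA subrK. Qed.

Lemma prime_in_sum (T : Type) (r : seq T) (P : pred T) (f : T -> Z) :
  (forall i, P i -> I (f i)) -> I (\sum_(i <- r | P i) f i).
Proof.
by move=> If; elim/big_ind: _ => //; [case: pI | apply: (prime_inD pI)].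
Qed.

Lemma prime_in_prod (T : eqType) (r : seq T) (f : T -> Z) :
    {in r, forall i, f i \in S} -> I (\prod_(i <- r) f i) ->
  exists2 i, i \in r & I (f i).
Proof.
elim: r => [|i r IHr] Sf; first by rewrite big_nil => /(prime_in1 pI).
have Sr : {in r, forall j, f j \in S}.
  by move=> j rj; apply: Sf; rewrite in_cons rj orbT.
rewrite big_cons => /(prime_inP pI)[||Ii|/IHr[]// j rj Ij].
- by rewrite Sf ?mem_head.
- by rewrite big_seq rpred_prod.
- by exists i; rewrite ?mem_head.
by exists j; rewrite // in_cons rj orbT.
Qed.

Lemma prime_in_exp a n : a \in S -> I (a ^+ n) -> I a.
Proof.
move=> Sa; elim: n => [/(prime_in1 pI) //|n IHn]; rewrite exprS.
by case/(prime_inP pI) => //; rewrite rpredX.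
Qed.

(* Gauss: take the first coefficients of the two factors outside [I]. *)
Lemma prime_in_poly :
  prime_in (polyOver_pred S) (fun p => forall i, I p`_i).
Proof.
split=> [i|p r Ip Ir i|p r /polyOverP Sp Ir i|/(_ 0%N)|p r /polyOverP Sp].
- by rewrite coef0; case: pI.
- by rewrite coefD; apply: (prime_inD pI).
- by rewrite coefM; apply: prime_in_sum => j _; apply: (prime_inM pI).
- by rewrite coef1; apply: (prime_in1 pI).
move=> /polyOverP Sr Ipr.
have first (f : {poly Z}) :
    ~ (forall i, I f`_i) ->
  exists2 i, ~ I f`_i & forall j, (j < i)%N -> I f`_j.
  move=> /existsNP[i0 nI0].
  have exi : exists i, `[< ~ I f`_i >] by exists i0; apply/asboolP.
  case: (ex_minnP exi) => i /asboolP nIi mini; exists i => // j ltji.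
  by apply: contrapT => nIj; have /mini := asboolT nIj; rewrite leqNgt ltji.
apply: contrapT => /not_orP[/first[i nIi Ii] /first[j nIj Ij]].
have /(prime_inP pI)[] // : I (p`_i * r`_j).
have := Ipr (i + j)%N; rewrite coefM.
have lti : (i < (i + j).+1)%N by rewrite ltnS leq_addr.
rewrite (bigD1 (Ordinal lti)) //= addKn => Isum.
rewrite -[X in I X](addrK (\sum_(k < (i + j).+1 | k != Ordinal lti)
  p`_k * r`_(i + j - k))).
apply: prime_inB => //; apply: prime_in_sum => k.
rewrite -val_eqE /= neq_ltn => /orP[ltki|ltik].
  by rewrite mulrC; apply: (prime_inM pI) => //; apply: Ii.
by apply: (prime_inM pI) => //; apply: Ij; rewrite ltn_subLR ?ltn_add2r // -ltnS.
Qed.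

(* The polynomial [P] with roots [zs] is fixed by [psi] modulo [I], hence
   [psi z] is again a root of [P] modulo [I]. *)
Lemma conjugate_root (psi : {rmorphism Z -> Z}) (zs : seq Z) z
    (P := \prod_(w <- zs) ('X - w%:P)) :
    {in zs, forall w, w \in S} -> z \in zs -> psi z \in S ->
    (forall i, I (psi P`_i - P`_i)) ->
  exists2 w, w \in zs & I (psi z - w).
Proof.
move=> Szs zs_z Spz IP; apply: prime_in_prod => [w /Szs Sw|]; first exact: rpredB.
have Pz : P.[z] = 0.
  by apply/eqP; rewrite -[_ == 0]/(root P z) root_prod_XsubC.
have -> : \prod_(w <- zs) (psi z - w) = P.[psi z] - psi P.[z].
  by rewrite Pz rmorph0 subr0 horner_prod; apply: eq_bigr => w _; rewrite !hornerE.
rewrite -horner_map -hornerN -hornerD horner_coef.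
apply: prime_in_sum => i _; rewrite mulrC; apply: (prime_inM pI).
  exact: rpredX.
by rewrite coefB coef_map; apply: prime_inBC; apply: IP.
Qed.

Lemma polyOver_XsubC_div (f : {poly Z}) u : u \in S -> f \in polyOver S ->
  exists2 g, g \in polyOver S & f = g * ('X - u%:P) + f.[u]%:P.
Proof.
move=> Su; elim/poly_ind: f => [|p c IHp] Sf.
  by exists 0; rewrite ?rpred0 // horner0 mul0r addr0.
have Sp : p \in polyOver S.
  apply/polyOverP => i; have /polyOverP/(_ i.+1) := Sf.
  by rewrite coefD coefC addr0 coefMX.
have [g Sg defp] := IHp Sp; exists (p + g * u%:P).
  by rewrite rpredD ?rpredM // polyOverC.
rewrite hornerMXaddC rmorphD rmorphM /= mulrDl -mulrA [u%:P * _]mulrC mulrA.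
rewrite addrA; congr (_ + _); rewrite -addrA -mulrDl -defp.
by rewrite mulrBr subrK.
Qed.

(** This is the bound on the number of roots over the domain [S/I], expressed by congruences. The
    induction splits off one linear factor at a time. *)
Lemma small_poly_roots_in (us : seq Z) (f : {poly Z}) :
    {in us, forall u, u \in S} -> uniq us ->
    {in us &, forall u v, I (u - v) -> u = v} ->
    f \in polyOver S -> {in us, forall u, I f.[u]} -> (size f <= size us)%N ->
  forall i, I f`_i.
Proof.
elim: us f => [|u us IHus] f Sus; first move=> _ _ _ _.
  by rewrite leqn0 size_poly_eq0 => /eqP-> i; rewrite coef0; case: pI.
case/andP=> u_us Uus inj_us Sf If szf.
have Su : u \in S by rewrite Sus ?mem_head.
have [g Sg deff] := polyOver_XsubC_div Su Sf.
have sub_us v : v \in us -> v \in u :: us by rewrite in_cons orbC => ->.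
have {}IHus : forall i, I g`_i.
  apply: IHus => // [v /sub_us/Sus //|v w /sub_us vus /sub_us/(inj_us _ _ vus) //||].
    move=> v us_v; have := If _ (sub_us _ us_v).
    rewrite deff hornerD hornerC hornerM hornerXsubC => Iv.
    have /(prime_inP pI)[] : I (g.[v] * (v - u)).
    - by rewrite -[_ * _](addrK f.[u]); apply: prime_inB => //; apply: If (mem_head _ _).
    - by rewrite rpred_horner // Sus ?sub_us.
    - by rewrite rpredB // Sus ?sub_us.
    - by [].
    move=> /(inj_us _ _ (sub_us _ us_v) (mem_head _ _)) vu.
    by rewrite vu (negbTE u_us) in us_v *.
  have [->|g0] := eqVneq g 0; first by rewrite size_poly0.
  rewrite -ltnS; apply: leq_trans szf.
  rewrite -[X in (X <= _)%N](_ : size (g * ('X - u%:P)) = _).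
    have -> : g * ('X - u%:P) = f - f.[u]%:P by rewrite {1}deff addrK.
    rewrite (leq_trans (size_polyD _ _)) // size_polyN geq_max leqnn /=.
    (* The constant has size at most 1, so only [f = 0] has to be excluded; it would force
       [g = 0]. *)
    rewrite (leq_trans (size_polyC_leq1 _)) // lt0n size_poly_eq0.
    apply: contraNneq g0 => f0; move: deff; rewrite f0 horner0 addr0 => /esym/eqP.
    by rewrite mulf_eq0 polyXsubC_eq0 orbF.
  by rewrite size_Mmonic ?monicXsubC // size_XsubC addn2.
move=> i; rewrite deff coefD mulrBr coefB coefMX coefMC.
apply: (prime_inD pI); first apply: prime_inB.
- by case: ifP => // _; case: pI.
- by rewrite mulrC; apply: (prime_inM pI).
by rewrite coefC; case: ifP => _; [apply: If (mem_head _ _) | case: pI].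
Qed.

End PrimeIdeals.

(** * Existence of a prime of the integral closure above [t] *)

Section PrimeOverT.
Variables (F : finFieldType) (E : fieldExtType (ratfun F)).
Local Notation T := (inE_pol E 'X).

Record proper_ideal_over (A : E -> Prop) : Prop := ProperIdealOver {
  pio_int : forall z, A z -> z \in integral_pred E;
  pioT : A T;
  pioD : forall a b, A a -> A b -> A (a + b);
  pioM : forall r a, r \in integral_pred E -> A a -> A (r * a);
  pio1 : ~ A 1 }.

(** The point is properness: [1/t] is not integral over [F[t]]. *)
Lemma proper_ideal_over_principal :
  proper_ideal_over (fun z => exists2 r, r \in integral_pred E & z = r * T).
Proof.
split=> [_ [r Rr ->]||_ _ [r Rr ->] [r' Rr' ->]|x _ Rx [r Rr ->]|[r]].
- by rewrite rpredM ?integral_inE_pol.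
- by exists 1; rewrite ?rpred1 ?mul1r.
- by exists (r + r'); rewrite ?rpredD ?mulrDl.
- by exists (x * r); rewrite ?rpredM ?mulrA.
case/integral_predP=> p p_monic /rootP pr0 rT1.
(* Multiplying the equation of [r] by [T ^+ deg p] gives [1 + T * g = 0]. *)
have : inE_pol E (\sum_(i < size p) p`_i * 'X^((size p).-1 - i)) = 0.
  rewrite -(mulr0 (T ^+ (size p).-1)) -pr0 horner_coef.
  rewrite size_map_poly_id0; last first.
    by rewrite (monicP p_monic) rmorph1 oner_neq0.
  rewrite mulr_sumr rmorph_sum; apply: eq_bigr => i _.
  rewrite coef_map rmorphM rmorphXn /= mulrCA; congr (_ * _).
  have lei : (i <= (size p).-1)%N by rewrite -ltnS (ltn_predK (ltn_ord i)).
  rewrite -{2}(subnK lei) exprD -mulrA -exprMn [T * r]mulrC -rT1.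
  by rewrite expr1n mulr1.
(* The relation descends to [F[t]]. At [t = 0] only the leading coefficient of [p] survives, which
   gives [1 = 0]. *)
rewrite -(rmorph0 (inE_pol E)) => /inE_pol_inj/(congr1 (horner^~ 0)).
rewrite horner_sum horner0.
have szp : (0 < size p)%N by rewrite size_poly_gt0 monic_neq0.
have ltn : ((size p).-1 < size p)%N by rewrite prednK.
rewrite (bigD1 (Ordinal ltn)) //= subnn expr0 mulr1 -[p`__]/(lead_coef p).
rewrite (monicP p_monic) hornerC big1 ?addr0 => [/eqP|i ni].
  by rewrite oner_eq0.
rewrite hornerM hornerXn expr0n subn_eq0 (_ : (_ <= _)%N = false) ?mulr0 //.
apply/negbTE; apply: contra ni => le_i; rewrite -val_eqE /= eqn_leq le_i andbT.
by rewrite -ltnS prednK.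
Qed.

Lemma proper_ideal_over_add A a : proper_ideal_over A -> a \in integral_pred E ->
    ~ (exists2 x, A x & exists2 r, r \in integral_pred E & 1 = x + r * a) ->
  proper_ideal_over
    (fun z => exists2 x, A x & exists2 r, r \in integral_pred E & z = x + r * a).
Proof.
move=> [AR AT AD AM A1] Ra n1.
split=> //= [_ [x Ax [r Rr ->]]||_ _ [x Ax [r Rr ->]] [y Ay [r' Rr' ->]]|].
- by apply: rpredD; [exact: AR | exact: rpredM].
- by exists T => //; exists 0; rewrite ?rpred0 // mul0r addr0.
- by exists (x + y); [exact: AD|exists (r + r'); rewrite ?rpredD // mulrDl addrACA].
move=> y _ Ry [x Ax [r Rr ->]]; exists (y * x); first exact: AM.
by exists (y * r); rewrite ?rpredM // mulrDr mulrA.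
Qed.

Lemma exists_maximal_ideal : exists2 J, proper_ideal_over J &
  forall A, proper_ideal_over A -> (forall z, J z -> A z) ->
    forall z, A z -> J z.
Proof.
pose le (A B : {A | proper_ideal_over A}) :=
  `[< forall z, sval A z -> sval B z >].
pose A0 : {A | proper_ideal_over A} := exist _ _ proper_ideal_over_principal.
have [|A B C /asboolP AB /asboolP BC|Ch totCh|[J pJ] maxJ] :=
  @classical_sets.ZL_preorder _ A0 le.
- by move=> A; apply/asboolP.
- by apply/asboolP => z /AB/BC.
(* A nonempty chain is bounded by its union, the empty one by the principal ideal. *)
- have [[B0 ChB0]|noB] := pselect (exists B, Ch B); last first.
    by exists A0 => B ChB; case: noB; exists B.
  have pU : proper_ideal_over (fun z => exists2 B, Ch B & sval B z).
    split=> [z [B _ Bz]||a b [B ChB Ba] [C ChC Cb]|r a Rr [B ChB Ba]|[B _]].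
    - exact: pio_int (svalP B) _ Bz.
    - by exists B0 => //; apply: pioT (svalP B0).
    - case: (totCh B C ChB ChC) => /asboolP le_BC.
        by exists C => //; apply: (pioD (svalP C)) => //; apply: le_BC.
      by exists B => //; apply: (pioD (svalP B)) => //; apply: le_BC.
    - by exists B => //; apply: (pioM (svalP B)).
    exact: pio1 (svalP B).
  by exists (exist _ _ pU) => B ChB; apply/asboolP => z Bz /=; exists B.
exists J => // A pA leJA.
by have /asboolP := maxJ (exist _ A pA) (asboolT leJA).
Qed.

Lemma exists_prime_over : exists2 J : E -> Prop, prime_ideal_R J & lies_over J 0.
Proof.
have [J pJ maxJ] := exists_maximal_ideal.
have J0 : J 0.
  by rewrite -(mul0r T); apply: (pioM pJ); rewrite ?rpred0 //; apply: pioT pJ.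
exists J.
  split=> [z /(pio_int pJ)/integral_predP //|].
  split=> //; [exact: pioD pJ| |exact: pio1 pJ|].
    by move=> r a /integral_predP; apply: (pioM pJ).
  (* If [1 = x + r * a] with [x] in [J], then [b = x * b + r * (a * b)] is in [J]. Otherwise
     [J + R a] is proper and maximality puts [a] in [J]. *)
  move=> a b /integral_predP Ra /integral_predP Rb Jab.
  have [[x Jx [r Rr def1]]|n1] :=
      pselect (exists2 x, J x & exists2 r, r \in integral_pred E & 1 = x + r * a).
    right; rewrite -[b]mul1r def1 mulrDl -mulrA.
    by apply: (pioD pJ); [rewrite mulrC|]; apply: (pioM pJ).
  left; apply: (maxJ _ (proper_ideal_over_add pJ Ra n1)) => [z Jz|].
    by exists z => //; exists 0; rewrite ?rpred0 // mul0r addr0.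
  by exists 0 => //; exists 1; rewrite ?rpred1 // mul1r add0r.
have JX g : J (inE_pol E (g * 'X)).
  by rewrite rmorphM; apply: (pioM pJ); [exact: integral_inE_pol | exact: pioT pJ].
move=> f; rewrite subr0; split=> [|/dvdpP[g ->] //].
(* A nonzero constant term would put a unit into [J]. *)
elim/poly_ind: f => [|f c _ Jf]; first by rewrite dvdp0.
rewrite dvdp_addr ?dvdp_mull //.
have [-> |c0] := eqVneq c 0; first by rewrite dvdp0.
case: (pio1 pJ); rewrite -(rmorph1 (inE_pol E)) -[1]/1%:P -(mulVf c0) polyCM rmorphM.
apply: (pioM pJ); first exact: integral_inE_pol.
have -> : c%:P = (f * 'X + c%:P) + (- f) * 'X by rewrite mulNr addrAC subrr add0r.
by rewrite rmorphD; apply: (pioD pJ); [exact: Jf | exact: JX].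
Qed.

End PrimeOverT.

(** * Frobenius elements *)

Section Frobenius.
Variables (F : finFieldType) (E : splittingFieldType (ratfun F)).
Implicit Types g h : gal_of {:E}.

Lemma galfM g h (x : E) : (g * h)%g x = h (g x).
Proof. by rewrite galM ?memvf. Qed.

Lemma gal_inE_pol g f : g (inE_pol E f) = inE_pol E f.
Proof. by rewrite linearZ /= rmorph1. Qed.

Lemma gal_const g a : g (constE E a) = constE E a.
Proof. exact: gal_inE_pol. Qed.

Lemma gal_integral g z : z \in integral_pred E -> g z \in integral_pred E.
Proof.
case/integral_predP=> p p_monic pz0; apply/integral_predP; exists p => //.
rewrite (_ : map_poly _ p = map_poly g (map_poly (inE_pol E) p)) ?rmorph_root //.
by rewrite -map_poly_comp; apply: eq_map_poly => f /=; rewrite gal_inE_pol.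
Qed.

Lemma mem_Gal1 g : g \in 'Gal({:E} / 1%AS)%g.
Proof.
by rewrite gal_kHom ?sub1v // k1AHom.
Qed.

Variables (J : E -> Prop) (pJ : prime_in (integral_pred E) J).

(* [zeta] packs all the [zs] as its coefficients, so that a single
   automorphism works for all of them. *)
Lemma simultaneous_conjugate (psi : {rmorphism E -> E})
    (H : {group gal_of {:E}}) (zs : seq E) :
    {in integral_pred E, forall z, psi z \in integral_pred E} ->
    {in integral_pred E, forall c,
       {in H, forall h, h c = c} -> J (psi c - c)} ->
    {in zs, forall z, z \in integral_pred E} ->
  exists2 h, h \in H & {in zs, forall z, J (psi z - h z)}.
Proof.
move=> Rpsi Jpsi Rzs; pose zeta := \poly_(i < size zs) zs`_i.
have Rzeta : zeta \is a polyOver (integral_pred E).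
  by apply/polyOver_poly => i ltis; rewrite Rzs ?mem_nth.
have Rmap h : map_poly h zeta \is a polyOver (integral_pred E).
  by apply/polyOverP => i; rewrite coef_map gal_integral ?(polyOverP Rzeta).
pose ws := [seq map_poly h zeta | h in H].
pose P := \prod_(w <- ws) ('X - w%:P).
have PE : P = \prod_(h in H) ('X - (map_poly h zeta)%:P) by rewrite /P big_image.
have RP : P \is a polyOver (polyOver_pred (integral_pred E)).
  by rewrite PE; apply: rpred_prod => h _; rewrite polyOverXsubC; apply: Rmap.
have Pinv g : g \in H -> map_poly (map_poly g) P = P.
  move=> Hg; rewrite PE rmorph_prod /= [RHS](reindex_inj (mulIg g)).
  apply: eq_big => h; first by rewrite groupMr.
  move=> _; rewrite rmorphB /= map_polyX map_polyC /= -map_poly_comp.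
  by congr ('X - _%:P); apply: eq_map_poly => x /=; rewrite galfM.
(* [conjugate_root] is applied over [{poly E}], with [psi] acting on coefficients and the prime of
   [prime_in_poly]. *)
have [w /imageP[h Hh ->] Jw] : exists2 w, w \in ws &
    forall i, J (map_poly psi zeta - w)`_i.
  apply: (conjugate_root (prime_in_poly pJ)).
  - by move=> _ /imageP[h _ ->].
  - apply/imageP; exists 1%g; first exact: group1.
    by rewrite map_poly_id // => x _; rewrite gal_id.
  - by apply/polyOverP => i; rewrite coef_map Rpsi ?(polyOverP Rzeta).
  move=> i j; rewrite coefB coef_map; apply: Jpsi => [|g Hg].
    by apply: (@polyOverP _ (integral_pred E)); apply/(polyOverP RP).
  by rewrite -/P -{2}(Pinv g Hg) coef_map coef_map.
exists h => // z zs_z; have := Jw (index z zs).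
by rewrite coefB !coef_map coef_poly index_mem zs_z nth_index.
Qed.

Hypotheses (JR : forall z, J z -> z \in integral_pred E) (J0 : lies_over J 0).

Lemma prime_frobE z : J z -> J (frobE E z).
Proof.
move=> Jz; rewrite /frobE -(ltn_predK (finNzRing_gt1 F)) exprSr.
by apply: (prime_inM pJ) => //; rewrite rpredX ?JR.
Qed.

Lemma residue_inE_pol f : J (inE_pol E f - constE E f.[0]).
Proof.
by rewrite -rmorphB /=; apply/J0; rewrite dvdp_XsubCl /root !hornerE subrr.
Qed.

(** A residue fixed by the [q]-power map is a root of [X^q - X], which already splits over [F]. *)
Lemma residue_const c : c \in integral_pred E -> J (frobE E c - c) ->
  exists a, J (c - constE E a).
Proof.
move=> Rc; rewrite frobE_sub_prod => /(prime_in_prod pJ)[a _|a _ Ja].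
  by rewrite rpredB ?integral_const.
by exists a.
Qed.

Lemma prime_const a : J (constE E a) -> a = 0.
Proof.
move=> Ja; apply: contrapT => /eqP a0; apply: (prime_in1 pJ).
rewrite -(rmorph1 (constE E)) -(mulVf a0) rmorphM.
by apply: (prime_inM pJ) => //; rewrite integral_const.
Qed.

(** If [b.[0]] is nonzero, the residue is [a.[0] / b.[0]]. Otherwise [a] lies in [J] as well, so
    both are divisible by ['X] and a common factor can be cancelled. *)
Lemma residue_ratio (a b : {poly F}) c : c \in integral_pred E -> b != 0 ->
  inE_pol E b * c = inE_pol E a -> exists e, J (c - constE E e).
Proof.
move=> Rc; have [n] := ubnP (size b); elim: n a b => // n IHn a b ltbn b0 bca.
have [b00|b00] := eqVneq b.[0] 0; last first.
  exists (b.[0]^-1 * a.[0]).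
  have -> : c - constE E (b.[0]^-1 * a.[0])
     = constE E b.[0]^-1 * (constE E b.[0] * c - constE E a.[0]).
    by rewrite mulrBr mulrA -!rmorphM mulVf // rmorph1 mul1r.
  apply: (prime_inM pJ); first exact: integral_const.
  apply: (prime_in_trans pJ) (residue_inE_pol a); rewrite -bca -mulrBl mulrC.
  by apply: (prime_inM pJ) => //; apply: (prime_inBC pJ) (residue_inE_pol b).
have /factor_theorem[b1 def_b] : root b 0 by apply/rootP.
have Xb : J (inE_pol E b) by apply/J0; rewrite dvdp_XsubCl; apply/rootP.
have : J (inE_pol E a) by rewrite -bca mulrC; apply: (prime_inM pJ).
move/J0; rewrite dvdp_XsubCl => /factor_theorem[a1 def_a].
have b1_0 : b1 != 0 by apply: contraNneq b0 => b1_0; rewrite def_b b1_0 mul0r.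
apply: (IHn a1 b1) => //.
  by move: ltbn; rewrite def_b size_Mmonic ?monicXsubC // size_XsubC addn2.
have T0 : inE_pol E ('X - 0%:P) != 0.
  by rewrite -(rmorph0 (inE_pol E)) (inj_eq (@inE_pol_inj _ E)) polyXsubC_eq0.
apply: (mulIf T0); rewrite mulrAC -!rmorphM /= -def_b -def_a.
by rewrite bca.
Qed.

Lemma residue_scalar k : k%:A \in integral_pred E -> exists e, J (k%:A - constE E e).
Proof.
by move=> Rk; have [a [b [b0 bka]]] := scalar_ratio E k; apply: residue_ratio bka.
Qed.

Lemma gal_eq_gen (vs : seq E) g h :
  <<1 & vs>>%VS = fullv -> {in vs, g =1 h} -> g = h.
Proof.
move=> gen_vs eq_gh; apply/eqP/gal_eqP => x _.
have : (<<1 & vs>> <= fixedField [set (g * h^-1)%g])%VS.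
  apply/Fadjoin_seqP; split=> [|v vs_v]; first exact: sub1v.
  apply/fixedFieldP => [|_ /set1P->]; first exact: memvf.
  by rewrite galfM eq_gh // -galfM mulgV gal_id.
rewrite gen_vs => /subvP/(_ x (memvf x))/(fixedFieldP (memvf x)) fix_x.
by rewrite -{2}(fix_x _ (set11 _)) -galfM mulgKV.
Qed.

Variable vs : seq E.
Hypotheses (galE : galois 1 {:E}) (gen_vs : <<1 & vs>>%VS = fullv).
Hypotheses (Rvs : {in vs, forall v, v \in integral_pred E}).
Hypotheses (Gvs : forall g, {in vs, forall v, g v \in vs}).
Hypotheses (inj_vs : {in vs &, forall u v, J (u - v) -> u = v}).

(** For [h = 1] this says that the inertia group of [J] is trivial. *)
Lemma gal_eq_mod g h : {in vs, forall v, J (g v - h v)} -> g = h.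
Proof.
move=> Jgh; apply: (gal_eq_gen gen_vs) => v vs_v.
by apply: inj_vs (Jgh v vs_v); apply: Gvs.
Qed.

(** A Galois invariant lies in [F(t)]; being integral, it has its residue in [F]. *)
Lemma frobE_fixed_residue c : c \in integral_pred E ->
  {in 'Gal({:E} / 1%AS)%g, forall g, g c = c} -> J (frobE E c - c).
Proof.
move=> Rc fix_c; have /vlineP[k ck] : c \in 1%VS.
  by rewrite -(galois_fixedField galE); apply/fixedFieldP; rewrite ?memvf.
rewrite ck in Rc *; have [e Je] := residue_scalar Rc.
apply: (prime_in_trans pJ (b := constE E e)); last exact: (prime_inBC pJ).
by rewrite -(frobE_const E e) -rmorphB; apply: prime_frobE.
Qed.

Lemma exists_frobenius_elt :
  exists s : gal_of {:E}, {in integral_pred E, forall z, J (s z - frobE E z)}.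
Proof.
have step zs := @simultaneous_conjugate (frobE E) 'Gal({:E} / 1%AS)%G zs
  (@frobE_integral _ E) frobE_fixed_residue.
have [s _ Js] := step vs Rvs; exists s => z Rz.
(* The automorphism found for [z :: vs] agrees with [s] on [vs] modulo [J], hence equals [s]. So [s]
   does not depend on [z]. *)
have [|h _ Jh] := step (z :: vs).
  by move=> v; rewrite in_cons => /predU1P[->//|/Rvs].
rewrite (_ : s = h); first by apply: (prime_inBC pJ); apply: Jh; rewrite mem_head.
apply: gal_eq_mod => v vs_v; apply: (prime_in_trans pJ (b := frobE E v)).
  by apply: (prime_inBC pJ); apply: Js.
by apply: Jh; rewrite in_cons vs_v orbT.
Qed.

Lemma exists_frobenius : exists s, frobenius_at J s.
Proof.
have [s Js] := exists_frobenius_elt; exists s.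
have sJ z : J z -> J (s z).
  move=> Jz; rewrite -[s z](subrK (frobE E z)); apply: (prime_inD pJ).
    by apply: Js; apply: JR.
  exact: prime_frobE.
(* The [q]-th power of the preimage of [z] is congruent to [z], so primality applies. *)
have sVJ z : J z -> J ((s^-1)%g z).
  move=> Jz; have Rz := gal_integral (s^-1)%g (JR Jz).
  apply: (prime_in_exp pJ (n := #|F|)) => //.
  have := Js _ Rz; rewrite -galfM mulVg gal_id => /(prime_inBC pJ)/(prime_inD pJ).
  by move=> /(_ _ Jz); rewrite subrK.
have Dpow n : in_decomp J (s ^+ n)%g.
  elim: n => [|n [_ [IHn IHVn]]].
    rewrite expg0; split; first exact: mem_Gal1.
    by split=> z Jz; [|exists z]; rewrite ?gal_id.
  split; first exact: mem_Gal1; rewrite expgSr; split=> z Jz.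
    by rewrite galfM; apply/sJ/IHn.
  have [w Jw swz] := IHVn _ (sVJ _ Jz); exists w => //.
  by rewrite galfM swz -galfM mulVg gal_id.
split; first exact: (Dpow 1%N).
split=> [g|z /integral_predP/Js //]; split=> [[_ [gJ _]]|[n ->]//].
(* Here [psi = g] and [H] is generated by [s]. An [s]-invariant [c] has residue fixed by the
   [q]-power map, so it is congruent to a constant; [g] fixes this constant and preserves [J]. *)
have [||_ /cycleP[n ->] Jg] := @simultaneous_conjugate g <[s]>%G vs _ _ Rvs.
- by move=> z; apply: gal_integral.
- move=> c Rc fix_c; have [|a Ja] := residue_const Rc.
    rewrite -{2}(fix_c s) ?cycle_id //; apply: (prime_inBC pJ); exact: Js.
  apply: (prime_in_trans pJ (b := constE E a)); last exact: (prime_inBC pJ).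
  by rewrite -(gal_const g a) -rmorphB; apply: gJ.
by exists n; apply: gal_eq_mod.
Qed.

End Frobenius.

(** * The invariant symplectic form *)

Section Form.
Variables (F : finFieldType) (E : splittingFieldType (ratfun F)).
Variables (m : nat) (M : {poly F}).
Local Notation T := (inE_pol E 'X).
Local Notation phi n := (iter n (frobE E)).
Implicit Types x y z : E.

Lemma iter_frobEM n : {morph phi n : x y / x * y}.
Proof. by elim: n => // n IHn x y; rewrite !iterS IHn rmorphM. Qed.

Lemma iter_frobED n : {morph phi n : x y / x + y}.
Proof. by elim: n => // n IHn x y; rewrite !iterS IHn rmorphD. Qed.

Lemma iter_frobEB n : {morph phi n : x y / x - y}.
Proof. by elim: n => // n IHn x y; rewrite !iterS IHn rmorphB. Qed.

Lemma iter_frobE_const n a : phi n (constE E a) = constE E a.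
Proof. by elim: n => // n IHn; rewrite iterS IHn frobE_const. Qed.

Lemma iter_frobE_eq0 n x : (phi n x == 0) = (x == 0).
Proof. by elim: n => // n IHn; rewrite iterS fmorph_eq0. Qed.

Definition evL x : E :=
  \sum_(i < size M) constE E M`_i * phi i x + T * phi m x.

Lemma rootsVE x : rootsV (Lpoly M m) x <-> evL x = 0.
Proof.
suff -> : evL x = (map_poly (in_alg E) (Lpoly M m)).[x].
  by split=> [/rootP|/eqP].
rewrite /Lpoly /qassoc /evL rmorphD rmorph_sum rmorphM /= hornerD horner_sum.
rewrite map_polyXn map_polyC hornerM hornerC hornerXn expX_card; congr (_ + _).
apply: eq_bigr => i _.
by rewrite rmorphM /= map_polyXn map_polyC hornerM hornerC hornerXn expX_card.
Qed.

(** With [w = y * phi j.+1 x - x * phi j.+1 y], the inner sum is the formal quotient of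
    [phi m w - phi (m - j.+1) w] by [phi 1 - 1]. *)
Definition form_val x y : E :=
  \sum_(j < m) constE E M`_(m + j.+1) *
    \sum_(i < j.+1) phi (m.-1 - i) (y * phi j.+1 x - x * phi j.+1 y).

Hypotheses (szM : size M = (2 * m).+1).
Hypotheses (symM : forall j, (j <= 2 * m)%N -> M`_j = M`_(2 * m - j)).

(** The exponents [m + j.+1] and [m - j.+1] carry equal coefficients; [T] joins the middle one. *)
Lemma evL_split x : evL x = (constE E M`_m + T) * phi m x +
  \sum_(j < m) constE E M`_(m + j.+1) * (phi (m + j.+1) x + phi (m - j.+1) x).
Proof.
rewrite /evL szM -(big_mkord predT (fun i => constE E M`_i * phi i x)).
rewrite (@big_cat_nat _ _ _ m) //=; last by rewrite mul2n -addnn -addnS leq_addr.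
rewrite [X in _ + X + _]big_nat_recl; last by rewrite mul2n -addnn leq_addr.
rewrite mulrDl [RHS]addrAC; congr (_ + _); rewrite addrCA; congr (_ + _).
under [in RHS]eq_bigr do rewrite mulrDr.
rewrite big_split /= addrC; congr (_ + _).
  rewrite (big_addn 0 _ m) mul2n -addnn addnK big_mkord.
  by apply: eq_bigr => j _; rewrite [(j + m)%N]addnC addnS.
rewrite big_nat_rev big_mkord; apply: eq_bigr => j _ /=; rewrite add0n.
rewrite symM; last by rewrite (leq_trans (leq_subr _ _)) // leq_pmull.
by rewrite mul2n -addnn subnBA // -addnA addKn.
Qed.

Lemma telescope_frobE n w : (n <= m)%N ->
  \sum_(i < n) (phi (m.-1 - i).+1 w - phi (m.-1 - i) w) = phi m w - phi (m - n) w.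
Proof.
elim: n => [|n IHn] lt_nm; first by rewrite big_ord0 subn0 subrr.
have eqn : (m.-1 - n).+1 = (m - n)%N by case: m lt_nm => // k; rewrite ltnS => /subSn.
rewrite big_ord_recr IHn ?(ltnW lt_nm) // [val _]/= eqn.
have -> : (m - n.+1)%N = (m.-1 - n)%N by rewrite subnS -eqn.
by rewrite /= addrA subrK.
Qed.

(** The middle term of [evL_split] contributes symmetrically in [x] and [y] and cancels. For each
    [j] the inner sum telescopes to [phi m w - phi (m - j.+1) w], which expands to the matching
    terms on the right. *)
Lemma frobE_form_val x y : frobE E (form_val x y) - form_val x y =
  phi m y * evL x - phi m x * evL y.
Proof.
rewrite !evL_split !mulrDr opprD addrACA.
rewrite (_ : _ * _ - phi m x * _ = 0) ?add0r; last first.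
  by rewrite ![phi m _ * (_ * _)]mulrCA [phi m x * _]mulrC subrr.
rewrite /form_val rmorph_sum -sumrB !mulr_sumr -sumrB; apply: eq_bigr => j _.
rewrite rmorphM /= frobE_const rmorph_sum -mulrBr -sumrB.
under eq_bigr do rewrite -iterS.
rewrite telescope_frobE // -!(iterS j) !iter_frobEB !iter_frobEM -!iterD subnK //.
set c := constE E _; rewrite ![phi m _ * (c * _)]mulrCA -mulrBr; congr (c * _).
rewrite !mulrDr opprB addrACA [phi m x * phi (m - _) y]mulrC.
by rewrite opprD [phi m y * phi (m - _) x]mulrC.
Qed.

End Form.

(** * Integrality, separability and number of the roots of [L] *)

Section Roots.
Variables (F : finFieldType) (E : splittingFieldType (ratfun F)).
Variables (m : nat) (M : {poly F}).
Local Notation q := #|F|.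
Hypotheses (m_gt0 : (0 < m)%N) (szM : size M = (2 * m).+1).
Hypotheses (M0 : M`_0 = 1) (MT : M`_(2 * m) = 1).

Lemma ltn_expq i j : (q ^ i < q ^ j)%N = (i < j)%N.
Proof. by rewrite ltn_exp2l ?finNzRing_gt1. Qed.

Lemma const_ratfun1M n : ((1 : F)%:P%:F)%:P * 'X^n = 'X^n :> {poly ratfun F}.
Proof.
have -> : ((1 : F)%:P%:F)%:P = 1 :> {poly ratfun F}.
  exact: (rmorph1 (polyC \o @FracField.tofrac {poly F} \o polyC)).
exact: (mul1r ('X^n : {poly ratfun F})).
Qed.

Lemma Lpoly_lead : exists2 N : {poly ratfun F},
  Lpoly M m = 'X^(q ^ (2 * m)) + N & (size N <= q ^ (2 * m))%N.
Proof.
have szt (c : ratfun F) i : (i < 2 * m)%N ->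
    (size (c%:P * 'X^(q ^ i))%R <= q ^ (2 * m))%N.
  move=> lti; rewrite mul_polyC (leq_trans (size_scale_leq _ _)) //.
  by rewrite size_polyXn ltn_expq.
rewrite /Lpoly /qassoc szM big_ord_recr [val _]/= MT [X in _ + X + _]const_ratfun1M.
rewrite addrAC addrC; eexists; first by [].
rewrite (leq_trans (size_polyD _ _)) // geq_max szt /=; last first.
  by rewrite ltn_Pmull.
rewrite (leq_trans (size_sum _ _ _)) //; apply/bigmax_leqP => i _.
exact: szt.
Qed.

Lemma size_Lpoly : size (Lpoly M m) = (q ^ (2 * m)).+1.
Proof.
by have [N -> szN] := Lpoly_lead; rewrite size_polyDl size_polyXn // ltnS.
Qed.

Lemma monic_Lpoly : Lpoly M m \is monic.
Proof.
have [N -> szN] := Lpoly_lead.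
by rewrite monicE lead_coefDl ?lead_coefXn // size_polyXn ltnS.
Qed.

Lemma rootsV_integral x : rootsV (E := E) (Lpoly M m) x -> x \in integral_pred E.
Proof.
move=> Vx; apply/integral_predP.
apply: (integral_root_monic (RtoK := inE_pol E)) Vx _.
  by rewrite monic_map ?monic_Lpoly.
apply/integral_poly => i; apply/integral_predP; move: i; apply/polyOverP.
rewrite /Lpoly /qassoc rmorphD rmorph_sum; apply: rpredD.
  apply: rpred_sum => i _; rewrite rmorphM /= map_polyXn map_polyC.
  by rewrite rpredM ?polyOverXn // polyOverC; apply: integral_inE_pol.
rewrite rmorphM /= map_polyXn map_polyC.
by rewrite rpredM ?polyOverXn // polyOverC; apply: integral_inE_pol.
Qed.

(** Only the exponent [q ^ 0] survives differentiation, and [0 < m] keeps the term in [t] away from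
    it. Separability of [L] follows. *)
Lemma deriv_Lpoly : (Lpoly M m)^`() = 1.
Proof.
have q0 : q%:R = 0 :> ratfun F.
  apply: (fmorph_inj (in_alg E)); rewrite rmorph_nat rmorph0; apply/eqP.
  apply: contraTT (finNzRing_gt1 F); rewrite natf_neq0_pchar.
  by move=> /(pnat_1 (pnat_card_pchar E)) ->.
have dt (c : ratfun F) i :
    (0 < i)%N -> (c%:P * 'X^(q ^ i))^`() = 0 :> {poly ratfun F}.
  case: i => // i _; rewrite mul_polyC derivZ derivXn -mulr_natr.
  by rewrite expnS natrM -(rmorph_nat polyC) q0 mul0r mulr0 scaler0.
rewrite /Lpoly /qassoc derivD dt // addr0 szM big_ord_recl derivD [val _]/= M0.
rewrite [X in X^`() + _]const_ratfun1M derivX raddf_sum big1 ?addr0 // => i _.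
exact: dt.
Qed.

Lemma Lpoly_roots :
    splittingFieldFor 1%VS (map_poly (in_alg E) (Lpoly M m)) fullv ->
  galois 1 {:E} /\
  exists vs : seq E, [/\ uniq vs, size vs = (q ^ (2 * m))%N,
    forall x, rootsV (Lpoly M m) x <-> x \in vs & <<1 & vs>>%VS = fullv].
Proof.
set p := map_poly _ _ => splitL.
have sepL : separable_poly p.
  by rewrite separable_poly.unlock /p deriv_map deriv_Lpoly rmorph1 coprimep1.
split.
  apply/splitting_galoisField; exists p; split=> //.
  by apply/polyOver1P; exists (Lpoly M m).
have [vs pvs gen_vs] := splitL; exists vs; split=> //.
- by rewrite -separable_prod_XsubC -(eqp_separable pvs).
- have := eqp_size pvs; rewrite size_prod_XsubC size_map_poly size_Lpoly.
  by case.
by move=> x; rewrite /rootsV -/p (eqp_root pvs) root_prod_XsubC.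
Qed.

End Roots.

(** * Bilinearity, invariance and nondegeneracy of the form on [V] *)

Section InvariantForm.
Variables (F : finFieldType) (E : splittingFieldType (ratfun F)).
Variables (m : nat) (M : {poly F}).
Local Notation q := #|F|.
Local Notation phi n := (iter n (frobE E)).
Local Notation form_val := (@form_val F E m M).
Local Notation evL := (@evL F E m M).
Local Notation V := (@rootsV F E (Lpoly M m)).
Hypotheses (m_gt0 : (0 < m)%N) (szM : size M = (2 * m).+1).
Hypotheses (symM : forall j, (j <= 2 * m)%N -> M`_j = M`_(2 * m - j)).
Hypothesis MT : M`_(2 * m) = 1.
Implicit Types x y z : E.

Lemma evL_linear a x y : evL (constE E a * x + y) = constE E a * evL x + evL y.
Proof.
rewrite /evL mulrDr mulr_sumr addrACA -big_split /=; congr (_ + _).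
  apply: eq_bigr => i _; rewrite iter_frobED iter_frobEM iter_frobE_const.
  by rewrite mulrDr mulrCA.
by rewrite iter_frobED iter_frobEM iter_frobE_const mulrDr mulrCA.
Qed.

Lemma evL_gal (g : gal_of {:E}) x : g (evL x) = evL (g x).
Proof.
have gphi n : g (phi n x) = phi n (g x) by rewrite -!expX_card rmorphXn.
rewrite /evL rmorphD rmorph_sum rmorphM /= gal_inE_pol gphi; congr (_ + _).
by apply: eq_bigr => i _; rewrite rmorphM /= gal_const gphi.
Qed.

Lemma rootsV_linear a x y : V x -> V y -> V (constE E a * x + y).
Proof. by rewrite !rootsVE evL_linear => -> ->; rewrite mulr0 addr0. Qed.

Lemma rootsV_gal (g : gal_of {:E}) x : V x -> V (g x).
Proof. by rewrite !rootsVE -evL_gal => ->; rewrite rmorph0. Qed.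

Lemma form_valC x y : form_val y x = - form_val x y.
Proof.
rewrite /form_val -sumrN; apply: eq_bigr => j _.
rewrite -[RHS]mulrN; congr (_ * _); rewrite -sumrN; apply: eq_bigr => i _.
by rewrite !iter_frobEB opprB.
Qed.

Lemma form_valxx x : form_val x x = 0.
Proof.
rewrite /form_val big1 // => j _; rewrite big1 ?mulr0 // => i _.
by rewrite iter_frobEB subrr.
Qed.

Lemma form_val_linear a x y z :
  form_val (constE E a * x + y) z = constE E a * form_val x z + form_val y z.
Proof.
rewrite /form_val mulr_sumr -big_split; apply: eq_bigr => j _.
rewrite [X in _ = X + _]mulrCA -[RHS]mulrDr; congr (_ * _).
rewrite mulr_sumr -big_split; apply: eq_bigr => i _.
rewrite (iter_frobED j.+1) (iter_frobEM j.+1) (iter_frobE_const E j.+1).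
rewrite -[X in _ = X * _ + _](iter_frobE_const E (m.-1 - i) a).
rewrite -iter_frobEM -iter_frobED.
congr (iter _ _ _); rewrite mulrBr !mulrDr mulrDl opprD addrACA.
by rewrite mulrCA !mulrA.
Qed.

Lemma form_val_gal (g : gal_of {:E}) x y :
  g (form_val x y) = form_val (g x) (g y).
Proof.
have gphi n z : g (phi n z) = phi n (g z) by rewrite -!expX_card rmorphXn.
rewrite /form_val rmorph_sum; apply: eq_bigr => j _.
rewrite rmorphM [X in X * _]gal_const rmorph_sum; congr (_ * _).
apply: eq_bigr => i _; rewrite [LHS]gphi rmorphB !rmorphM.
by congr (iter _ _ (_ * _ - _ * _)); apply: gphi.
Qed.

Lemma form_val_const x y : V x -> V y -> exists a, form_val x y = constE E a.
Proof.
move=> /rootsVE Vx /rootsVE Vy; apply: frobE_fixed; apply/eqP.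
by rewrite -subr_eq0 (frobE_form_val szM symM) Vx Vy !mulr0 subr0.
Qed.

(** [form_val x] as a polynomial in its second argument, whose roots can be counted. *)
Definition form_poly x : {poly E} :=
  \sum_(j < m) (constE E M`_(m + j.+1))%:P * \sum_(i < j.+1)
    ((phi (m.-1 - i + j.+1) x)%:P * 'X^(q ^ (m.-1 - i)) -
     (phi (m.-1 - i) x)%:P * 'X^(q ^ (m.-1 - i + j.+1))).

Lemma horner_form_poly x y : (form_poly x).[y] = form_val x y.
Proof.
rewrite /form_poly /form_val horner_sum; apply: eq_bigr => j _.
rewrite hornerM hornerC horner_sum; congr (_ * _); apply: eq_bigr => i _.
rewrite hornerD hornerN !hornerM !hornerC !hornerXn !expX_card.
by rewrite iter_frobEB !iter_frobEM -!iterD mulrC.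
Qed.

Lemma coef_form_poly x k : (form_poly x)`_k =
  \sum_(j < m) constE E M`_(m + j.+1) * \sum_(i < j.+1)
    (phi (m.-1 - i + j.+1) x * (k == q ^ (m.-1 - i))%N%:R -
     phi (m.-1 - i) x * (k == q ^ (m.-1 - i + j.+1))%N%:R).
Proof.
rewrite /form_poly coef_sum; apply: eq_bigr => j _; rewrite coefCM; congr (_ * _).
by rewrite coef_sum; apply: eq_bigr => i _; rewrite coefB !coefCM !coefXn.
Qed.

Lemma form_exponent_lt i j : (j < m)%N -> (m.-1 - i + j.+1 < 2 * m)%N.
Proof. by lia. Qed.

Lemma size_form_poly x : (size (form_poly x) <= q ^ (2 * m))%N.
Proof.
apply/leq_sizeP => k lek; rewrite coef_form_poly big1 // => j _.
rewrite big1 ?mulr0 // => i _.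
have gtF e : (e < 2 * m)%N -> (k == q ^ e)%N = false.
  by move=> lte; rewrite gtn_eqF // (leq_trans _ lek) // ltn_expq.
have lti := form_exponent_lt i (ltn_ord j).
by rewrite !gtF ?mulr0 ?subrr // (leq_ltn_trans _ lti) // leq_addr.
Qed.

Lemma lead_form_poly x : (form_poly x)`_(q ^ (2 * m).-1) = - phi m.-1 x.
Proof.
have ltm : (m.-1 < m)%N by rewrite prednK.
have expq_eq i j : (q ^ i == q ^ j)%N = (i == j).
  by rewrite eqn_exp2l ?finNzRing_gt1.
have low i : ((2 * m).-1 == m.-1 - i)%N = false by apply/eqP; lia.
rewrite coef_form_poly (bigD1 (Ordinal ltm)) //= [X in _ + X]big1 => [|j nj]; last first.
  rewrite big1 ?mulr0 // => i _; rewrite !expq_eq low.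
  have -> : ((2 * m).-1 == m.-1 - i + j.+1)%N = false; last by rewrite !mulr0 subrr.
  by apply/eqP; move: nj; rewrite -val_eqE /=; have := ltn_ord j; lia.
rewrite addr0 (bigD1 ord0) //= [X in _ + X]big1 => [|i ni]; last first.
  rewrite !expq_eq low.
  have -> : ((2 * m).-1 == m.-1 - i + m.-1.+1)%N = false; last first.
    by rewrite !mulr0 subrr.
  by apply/eqP; move: ni; rewrite -val_eqE /=; have := ltn_ord i; lia.
rewrite !expq_eq low subn0.
have -> : (m + m.-1.+1 = 2 * m)%N by lia.
have -> : ((2 * m).-1 == m.-1 + m.-1.+1)%N by apply/eqP; lia.
by rewrite MT rmorph1 mul1r mulr0 mulr1 sub0r addr0.
Qed.

Lemma exists_invariant_form (vs : seq E) :
    uniq vs -> size vs = (q ^ (2 * m))%N -> (forall x, V x <-> x \in vs) ->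
  exists B, invariant_symplectic_form (E := E) (Lpoly M m) B.
Proof.
move=> Uvs szvs Vvs.
(* The default 0 is taken only outside [V], since on [V] the value of [form_val] is a constant. *)
pose B x y : F := odflt 0 [pick a | constE E a == form_val x y].
have BE x y : V x -> V y -> constE E (B x y) = form_val x y.
  move=> Vx Vy; rewrite /B; case: pickP => [a /eqP //|noa].
  by have [a fxy] := form_val_const Vx Vy; have := noa a; rewrite fxy eqxx.
have Cinj : injective (constE E) by apply: fmorph_inj.
exists B; split.
- move=> a x y z Vx Vy Vz; apply: Cinj; rewrite rmorphD rmorphM /= !BE //.
    exact: form_val_linear.
  exact: rootsV_linear.
- move=> a x y z Vx Vy Vz; apply: Cinj; rewrite rmorphD rmorphM /= !BE //.
    rewrite form_valC form_val_linear opprD -mulrN.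
    by rewrite [form_val z x]form_valC [form_val z y]form_valC.
  exact: rootsV_linear.
- by move=> x Vx; apply: Cinj; rewrite BE // form_valxx rmorph0.
(* If [x] is orthogonal to [V], then [form_poly x] has too many roots and vanishes, and so does its
   coefficient [- phi m.-1 x]. *)
- move=> x Vx Bx0; apply/eqP; rewrite -(iter_frobE_eq0 m.-1) -oppr_eq0.
  rewrite -lead_form_poly; have [->|N0] := eqVneq (form_poly x) 0.
    by rewrite coef0.
  have /(max_poly_roots N0)/(_ Uvs) : all (root (form_poly x)) vs.
    apply/allP => y /Vvs Vy; apply/rootP.
    by rewrite horner_form_poly -BE // Bx0 // rmorph0.
  by rewrite szvs ltnNge size_form_poly.
move=> g x y _ Vx Vy; apply: Cinj.
have [Vgx Vgy] := (rootsV_gal g Vx, rootsV_gal g Vy); rewrite !BE //.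
by rewrite -form_val_gal -BE // gal_const.
Qed.

End InvariantForm.

(** * The action of the Frobenius element on the roots *)

Section PolyFacts.
Variable F : fieldType.
Implicit Types f g p : {poly F}.

Lemma irreducible_factor f : (1 < size f)%N ->
  exists2 p, irreducible_poly p & p %| f.
Proof.
have [n] := ubnP (size f); elim: n f => // n IHn f ltfn f_gt1.
have [irr|nirr] := pselect (irreducible_poly f); first by exists f.
have [g /not_implyP[szg /not_implyP[gf /negP ngf]]] :
    exists g, ~ (size g != 1%N -> g %| f -> g %= f).
  by apply/existsNP => irr; apply: nirr; split.
have f0 : f != 0 by rewrite -size_poly_gt0 ltnW.
have g_gt0 : (0 < size g)%N by rewrite size_poly_gt0 (dvdpN0 gf).
have ltg : (size g < size f)%N.
  by rewrite ltn_neqAle (dvdp_leq f0 gf) andbT (dvdp_size_eqp gf).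
have [||p irr_p pg] := IHn g; first exact: leq_trans ltg _.
  by rewrite ltn_neqAle eq_sym szg.
by exists p => //; apply: dvdp_trans gf.
Qed.

(** An irreducible factor [p] of [f / gcd(f, g)] would divide [g ^+ n], hence [g] and the gcd, so
    that [p ^+ 2] would divide [f]. *)
Lemma squarefree_dvd_exp f g n : f != 0 ->
    (forall p, irreducible_poly p -> ~~ (p ^+ 2 %| f)) -> f %| g ^+ n ->
  f %| g.
Proof.
move=> f0 sqf fgn; have /dvdpP[e fe] := dvdp_gcdl f g.
suff /eqP : size e = 1%N.
  rewrite size_poly_eq1 => /(eqp_mulr (gcdp f g)); rewrite -fe mul1r.
  by move=> /eqp_dvdl ->; apply: dvdp_gcdr.
apply/eqP; rewrite eqn_leq size_poly_gt0 andbC.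
have -> : e != 0 by apply: contraNneq f0 => e0; rewrite fe e0 mul0r.
rewrite leqNgt; apply/negP => /irreducible_factor[p irr_p pe].
have pf : p %| f by rewrite fe dvdp_mulr.
have pg : p %| g.
  have [/(coprimep_expr n)|ncop] := boolP (coprimep p g).
    move=> /coprimepP/(_ p (dvdpp p) (dvdp_trans pf fgn)).
    by rewrite -size_poly_eq1; case: irr_p => + _ => /gtn_eqF ->.
  by rewrite -(eqp_dvdl _ (irr_p _ ncop (dvdp_gcdl p g))) dvdp_gcdr.
by have /negP[] := sqf p irr_p; rewrite fe expr2 dvdp_mul // dvdp_gcd pf.
Qed.

(** The derivative of [X^r - 1] at 1 is [r], and a double root makes it vanish. *)
Lemma Xn_sub1_multiple_root r :
  ('X - 1) ^+ 2 %| ('X^r - 1 : {poly F}) -> r%:R = 0 :> F.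
Proof.
case/dvdpP=> g /(congr1 (fun f => f^`().[1])).
rewrite derivB derivXn derivC subr0 hornerMn hornerXn expr1n => ->.
have X0 : ('X - 1 : {poly F}).[1] = 0 by rewrite hornerD hornerN hornerX hornerC subrr.
by rewrite expr2 mulrA derivM hornerD !hornerM X0 !(mulr0, mul0r) addr0.
Qed.

Lemma Xn_sub1_pchar (p r n : nat) : p \in [pchar F] ->
  'X^(r * p ^ n) - 1 = ('X^r - 1) ^+ (p ^ n) :> {poly F}.
Proof.
move=> pF; have pP : [pchar {poly F}].-nat (p ^ n)%N.
  rewrite (eq_pnat _ (pchar_poly F)) (eq_pnat _ (pcharf_eq pF)) pnatX.
  by rewrite pnat_id ?(pcharf_prime pF).
by rewrite exprDn_pchar // exprNn_pchar // expr1n exprM.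
Qed.

End PolyFacts.

(** * The action of [F[X]] on [E] through an automorphism *)

Section Action.
Variables (F : finFieldType) (E : splittingFieldType (ratfun F)).
Variable s : gal_of {:E}.
Implicit Types (f g : {poly F}) (x y : E).

(** The operator [f(s)]: [E] becomes an [F[X]]-module on which ['X] acts as [s]. *)
Definition pact f x : E := \sum_(i < size f) constE E f`_i * (s ^+ i)%g x.

Lemma pactE n f x : (size f <= n)%N ->
  pact f x = \sum_(i < n) constE E f`_i * (s ^+ i)%g x.
Proof.
move=> lefn; rewrite /pact.
rewrite (big_ord_widen n (fun i => constE E f`_i * (s ^+ i)%g x) lefn) big_mkcond.
apply: eq_bigr => i _; case: ifP => // /negbT; rewrite -leqNgt => lefi.
by rewrite nth_default // rmorph0 mul0r.
Qed.

Lemma pactD f g x : pact (f + g) x = pact f x + pact g x.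
Proof.
pose n := maxn (size f) (size g); rewrite !(@pactE n) ?leq_maxl ?leq_maxr ?size_polyD //.
by rewrite -big_split; apply: eq_bigr => i _; rewrite coefD rmorphD mulrDl.
Qed.

Lemma pactC a x : pact a%:P x = constE E a * x.
Proof. by rewrite (@pactE 1) ?size_polyC_leq1 // big_ord1 coefC gal_id. Qed.

Lemma pactMX f x : pact (f * 'X) x = pact f (s x).
Proof.
rewrite (@pactE (size f).+1); last first.
  by rewrite (leq_trans (size_polyMleq _ _)) // size_polyX addn2.
rewrite big_ord_recl coefMX rmorph0 mul0r add0r; apply: eq_bigr => i _.
by rewrite coefMX -galfM -expgS.
Qed.

Lemma pact0 f : pact f 0 = 0.
Proof. by rewrite /pact big1 // => i _; rewrite rmorph0 mulr0. Qed.

Lemma pact_gal f x : pact f (s x) = s (pact f x).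
Proof.
rewrite /pact rmorph_sum; apply: eq_bigr => i _ /=.
by rewrite rmorphM /= gal_const -!galfM -expgS -expgSr.
Qed.

Lemma pactM f g x : pact (f * g) x = pact f (pact g x).
Proof.
elim/poly_ind: f x => [|f c IHf] x.
  by rewrite mul0r -[0]/(0%:P) !pactC rmorph0 !mul0r.
rewrite mulrDl !pactD mulrAC !pactMX IHf pact_gal pactC; congr (_ + _).
have actCM h y : pact (c%:P * h) y = constE E c * pact h y.
  rewrite mulrC; elim/poly_ind: h y => [|h d IHh] y.
    by rewrite mul0r -[0]/(0%:P) !pactC rmorph0 !mul0r mulr0.
  rewrite mulrDl mulrAC !pactD !pactMX IHh -polyCM !pactC mulrDr rmorphM.
  by rewrite mulrCA mulrA.
exact: actCM.
Qed.

Lemma pactXn n x : pact 'X^n x = (s ^+ n)%g x.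
Proof.
elim: n x => [|n IHn] x; first by rewrite -[_ ^+ 0]/(1%:P) pactC rmorph1 mul1r gal_id.
by rewrite exprSr pactMX IHn expgS galfM.
Qed.

Lemma pactXn_sub1 n x : pact ('X^n - 1) x = (s ^+ n)%g x - x.
Proof. by rewrite pactD pactXn -polyCN pactC rmorphN1 mulN1r. Qed.

End Action.

(** * The annihilator of Frobenius on [V], and the transvection among its powers *)

Section FrobeniusAction.
Variables (F : finFieldType) (E : splittingFieldType (ratfun F)).
Variables (m : nat) (M : {poly F}).
Local Notation q := #|F|.
Local Notation phi n := (iter n (frobE E)).
Local Notation V := (@rootsV F E (Lpoly M m)).
Local Notation T := (inE_pol E 'X).
Hypotheses (m_gt0 : (0 < m)%N) (szM : size M = (2 * m).+1).
Hypotheses (M0 : M`_0 = 1) (MT : M`_(2 * m) = 1).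
Variable J : E -> Prop.
Hypotheses (pJ : prime_in (integral_pred E) J) (J0 : lies_over J 0).
Hypothesis JR : forall z, J z -> z \in integral_pred E.
Implicit Types (f : {poly F}) (x y : E).

Lemma prime_T : J T.
Proof. by apply/J0; rewrite subr0. Qed.

(* A nonzero root [x] of [L] in [J] satisfies [1 + x * r = 0] with [r] integral. *)
Lemma rootsV_prime x : V x -> J x -> x = 0.
Proof.
move=> Vx Jx; have Rx := rootsV_integral m_gt0 szM MT Vx.
(* Since [q ^ i.+1] is at least 2, every term of [L] but the linear one contains [x] twice. *)
have pow2 i : phi i.+1 x = x * (x * x ^+ (q ^ i.+1 - 2)).
  rewrite -expX_card -!exprS; rewrite -addn2 subnK // expnS.
  by rewrite (leq_trans (finNzRing_gt1 F)) // leq_pmulr // expn_gt0 ltnW // finNzRing_gt1.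
move/rootsVE: Vx; rewrite /evL szM big_ord_recl M0 rmorph1 mul1r.
have -> : phi m x = x * (x * x ^+ (q ^ m - 2)) by have := pow2 m.-1; rewrite prednK.
under eq_bigr do rewrite [phi _ x]pow2 mulrCA [X in _ * X]mulrCA.
rewrite -!mulr_sumr -addrA (mulrCA T) (mulrCA T) -!mulrDr -[X in X + _]mulr1 -mulrDr.
move/eqP; rewrite mulf_eq0 => /orP[/eqP //|/eqP eq0]; case: (prime_in1 pJ).
have -> : 1 = - (x * (\sum_(i < 2 * m) constE E M`_(lift ord0 i) *
    x ^+ (q ^ (lift ord0 i) - 2) + T * x ^+ (q ^ m - 2))).
  by apply/eqP; rewrite -subr_eq0 opprK eq0.
apply: (prime_inN pJ); rewrite mulrC; apply: (prime_inM pJ) => //.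
rewrite rpredD ?rpredM ?rpredX ?integral_inE_pol // rpred_sum // => i _.
by rewrite rpredM ?rpredX ?integral_const.
Qed.

Lemma rootsVB x y : V x -> V y -> V (x - y).
Proof.
move=> Vx Vy; rewrite -[x - y]addrC -mulN1r -(rmorphN1 (constE E)).
exact: rootsV_linear.
Qed.

Lemma rootsV_mod_inj x y : V x -> V y -> J (x - y) -> x = y.
Proof.
by move=> Vx Vy /(rootsV_prime (rootsVB Vx Vy))/eqP; rewrite subr_eq0 => /eqP.
Qed.

Variable s : gal_of {:E}.
Hypothesis Js : {in integral_pred E, forall z, J (s z - frobE E z)}.
Local Notation pact := (pact s).

Lemma rootsV_pact f x : V x -> V (pact f x).
Proof.
move=> Vx; rewrite /pact; apply: (big_ind V) => [|y z Vy Vz|i _].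
- by rewrite -(subrr x); apply: rootsVB.
- by rewrite -[y]mul1r -(rmorph1 (constE E)); apply: rootsV_linear.
have V0 : V 0 by rewrite -(subrr x); apply: rootsVB.
by rewrite -[_ * _]addr0; apply: rootsV_linear => //; apply: rootsV_gal.
Qed.

Lemma frobenius_pow x n : x \in integral_pred E -> J ((s ^+ n)%g x - phi n x).
Proof.
move=> Rx; elim: n => [|n IHn]; first by rewrite gal_id subrr; case: pJ.
rewrite expgSr galfM iterS; apply: (prime_in_trans pJ).
  by apply: Js; apply: gal_integral.
by rewrite -rmorphB; apply: (prime_frobE pJ).
Qed.

Lemma pact_mod f x : x \in integral_pred E ->
  J (pact f x - \sum_(i < size f) constE E f`_i * phi i x).
Proof.
move=> Rx; rewrite /pact -sumrB; apply: (prime_in_sum pJ) => i _.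
rewrite -mulrBr; apply: (prime_inM pJ); first exact: integral_const.
exact: frobenius_pow.
Qed.

(** Modulo [J], [s] acts as the [q]-power map and [t] vanishes, so [M(s) x] is congruent to
    [L(x) = 0]; a root of [L] in [J] is 0. *)
Lemma pact_M x : V x -> pact M x = 0.
Proof.
move=> Vx; have Rx := rootsV_integral m_gt0 szM MT Vx.
apply: rootsV_prime; first exact: rootsV_pact.
have := pact_mod M Rx; have /rootsVE := Vx; rewrite /evL => /eqP.
rewrite addr_eq0 => /eqP ->; rewrite opprK => JT.
rewrite -[pact M x](addrK (T * phi m x)); apply: (prime_inB pJ) => //.
rewrite mulrC; apply: (prime_inM pJ); last exact: prime_T.
by rewrite -expX_card rpredX.
Qed.

Variable vs : seq E.
Hypotheses (Uvs : uniq vs) (szvs : size vs = (q ^ (2 * m))%N).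
Hypothesis Vvs : forall x, V x <-> x \in vs.

(** The [q]-polynomial [P] attached to [f] has degree less than [q ^ (2 * m)] and vanishes modulo
    [J] on [V], whose elements are distinct modulo [J]. Its coefficients are then constants in [J],
    that is, 0. *)
Lemma pact_eq0_small f : (size f <= 2 * m)%N -> (forall x, V x -> pact f x = 0) ->
  f = 0.
Proof.
move=> szf f0; pose P := \sum_(i < size f) (constE E f`_i)%:P * 'X^(q ^ i).
have JP : forall k, J P`_k.
  apply: (small_poly_roots_in pJ (us := vs)) => //.
  - by move=> x /Vvs/rootsV_integral; apply.
  - by move=> x y /Vvs Vx /Vvs Vy; apply: rootsV_mod_inj.
  - apply: rpred_sum => i _; rewrite rpredM ?polyOverXn //.
    by rewrite polyOverC integral_const.
  - move=> x /Vvs Vx; have := pact_mod f (rootsV_integral m_gt0 szM MT Vx).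
    rewrite f0 // sub0r => /(prime_inN pJ); rewrite opprK.
    rewrite /P horner_sum; congr (J _); apply: eq_bigr => i _.
    by rewrite hornerM hornerC hornerXn expX_card.
  rewrite szvs (leq_trans (size_sum _ _ _)) //; apply/bigmax_leqP => i _.
  rewrite mul_polyC (leq_trans (size_scale_leq _ _)) // size_polyXn ltn_expq.
  exact: leq_trans szf.
apply/polyP => k; rewrite coef0; have [lek|ltk] := leqP (size f) k.
  by rewrite nth_default.
apply: (prime_const pJ); have := JP (q ^ k)%N.
rewrite /P coef_sum (bigD1 (Ordinal ltk)) //= coefCM coefXn eqxx mulr1.
rewrite big1 ?addr0 // => i; rewrite -val_eqE /= => nik.
by rewrite coefCM coefXn eqn_exp2l ?finNzRing_gt1 // eq_sym (negbTE nik) mulr0.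
Qed.

Lemma pact_eq0_dvd f : (forall x, V x -> pact f x = 0) -> M %| f.
Proof.
have Mn0 : M != 0 by rewrite -size_poly_gt0 szM.
move=> f0; apply/modp_eq0P; apply: pact_eq0_small.
  by rewrite -ltnS -szM ltn_modp.
move=> x Vx; have := f0 x Vx; rewrite {1}(divp_eq f M) pactD pactM pact_M //.
by rewrite pact0 add0r.
Qed.

Lemma pact_dvd f x : M %| f -> V x -> pact f x = 0.
Proof. by case/dvdpP=> g -> Vx; rewrite pactM pact_M ?pact0. Qed.

Hypotheses (dM2 : ('X - 1) ^+ 2 %| M).
Local Notation M1 := (M %/ ('X - 1) ^+ 2).
Hypotheses (nM1 : ~~ (('X - 1) %| M1)).
Hypothesis sqfM1 : forall p : {poly F}, irreducible_poly p -> ~~ (p ^+ 2 %| M1).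

Lemma frobenius_pow_transvection : exists k, transvection_on (Lpoly M m) (s ^+ k)%g.
Proof.
have Mn0 : M != 0 by rewrite -size_poly_gt0 szM.
have defM : M = M1 * ('X - 1) ^+ 2 by rewrite divpK.
have M1n0 : M1 != 0 by apply: contraNneq Mn0 => M10; rewrite defM M10 mul0r.
have [p p_pr pF] := finPcharP F.
pose r := partn #[s]%g p^'; exists r.
have r0 : r%:R != 0 :> F.
  by rewrite natf_neq0_pchar (eq_pnat _ (eq_negn (pcharf_eq pF))) part_pnat.
have order_s : #[s]%g = (r * p ^ logn p #[s]%g)%N.
  by rewrite -p_part mulnC partnC ?order_gt0.
(* [M1] divides [X^n - 1] for [n] the order of [s], and this is a power of [X^r - 1]. *)
have M1r : M1 %| 'X^r - 1.
  apply: (squarefree_dvd_exp (n := (p ^ logn p #[s]%g)%N)) => //.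
  rewrite -Xn_sub1_pchar // -order_s.
  apply: dvdp_trans (_ : M %| _); first by rewrite {2}defM dvdp_mulr.
  by apply: pact_eq0_dvd => x Vx; rewrite pactXn_sub1 expg_order gal_id subrr.
have Xr : ('X - 1) * M1 %| 'X^r - 1.
  rewrite Gauss_dvdp ?M1r ?andbT; last first.
    by rewrite coprimep_sym coprimep_XsubC -dvdp_XsubCl.
  by rewrite dvdp_XsubCl /root !hornerE expr1n subrr.
have Xr2 : M %| ('X - 1) * ('X^r - 1).
  have -> : M = ('X - 1) * (('X - 1) * M1) by rewrite [LHS]defM expr2 mulrC mulrA.
  by rewrite dvdp_mul.
have tauE x : (s ^+ r)%g x - x = pact ('X^r - 1) x by rewrite pactXn_sub1.
pose w x := (s ^+ r)%g x - x.
have Vw x : V x -> V (w x) by move=> Vx; rewrite /w tauE; apply: rootsV_pact.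
(* As [M] divides [(X - 1) (X^r - 1)], the image of [w] on [V] is fixed by [s]. *)
have sw x : V x -> s (w x) = w x.
  move=> Vx; apply/eqP; rewrite -subr_eq0.
  have := pact_dvd Xr2 Vx; rewrite pactM -tauE -/(w x).
  by rewrite -[in 'X - 1](expr1 'X) pactXn_sub1 expg1 => ->.
(* Otherwise [M], and with it [(X - 1)^2], would divide [X^r - 1], forcing [r = 0] in [F]. *)
have [x0 Vx0 wx0] : exists2 x, V x & w x != 0.
  apply: contrapT => now; have /negP[] := r0; apply/eqP.
  apply: Xn_sub1_multiple_root; apply: dvdp_trans dM2 _.
  apply: pact_eq0_dvd => x Vx; rewrite -tauE; apply: contrapT => /eqP wx.
  by apply: now; exists x.
have res x : V x -> exists a, J (w x - constE E a).
  move=> Vx; have Rw := rootsV_integral m_gt0 szM MT (Vw x Vx).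
  apply: (residue_const pJ) => //; rewrite -{2}(sw x Vx).
  by apply: (prime_inBC pJ); apply: Js.
split; [|split].
- move=> x Vx.
  have : M %| ('X^r - 1) * ('X^r - 1).
    apply: dvdp_trans Xr2 _; apply: dvdp_mul => //.
    by apply: dvdp_trans Xr; rewrite dvdp_mulr.
  move/pact_dvd/(_ Vx); rewrite pactM -!tauE rmorphB /= => <-.
  by rewrite mulr_natl mulr2n opprD opprB !addrA [RHS]addrAC.
- by exists x0; split=> //; rewrite -subr_eq0.
exists (w x0) => // x Vx; have [[a Ja] [b Jb]] := (res x Vx, res x0 Vx0).
have b0 : b != 0.
  apply: contraNneq wx0 => b0; rewrite b0 rmorph0 subr0 in Jb.
  by rewrite (rootsV_prime (Vw x0 Vx0) Jb).
(* Both sides are roots of [L] with residue [a], hence equal. *)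
exists (a / b); apply: rootsV_mod_inj; first exact: Vw.
  rewrite -[_ * _]addr0; apply: rootsV_linear; first exact: Vw.
  by rewrite -(subrr x0); apply: rootsVB.
apply: (prime_in_trans pJ Ja); apply: (prime_inBC pJ).
have -> : constE E (a / b) * w x0 - constE E a
    = constE E (a / b) * (w x0 - constE E b).
  by rewrite [RHS]mulrBr -(rmorphM (constE E)) divfK.
by apply: (prime_inM pJ) => //; apply: integral_const.
Qed.

End FrobeniusAction.

Lemma prime_ideal_R_prime_in (F : finFieldType) (E : fieldExtType (ratfun F))
  (J : E -> Prop) : prime_ideal_R J -> prime_in (integral_pred E) J.
Proof.
case=> _ [J0 JD JM J1 JP]; split=> // [r a /integral_predP|a b].
  exact: JM.
by move=> /integral_predP Ra /integral_predP; apply: JP.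
Qed.

Theorem theorem3p5 (F : finFieldType) (m : nat) (M : {poly F})
  (E : splittingFieldType (ratfun F)) :
  (1 <= m)%N ->
  size M = (2 * m).+1 ->
  self_reciprocal M ->
  M`_0 = 1 ->
  ('X - 1) ^+ 2 %| M ->
  ~~ (('X - 1) ^+ 3 %| M) ->
  ~~ (('X - 1) %| M %/ ('X - 1) ^+ 2) ->
  ~~ (('X + 1) %| M %/ ('X - 1) ^+ 2) ->
  (forall p : {poly F}, irreducible_poly p -> ~~ (p ^+ 2 %| M %/ ('X - 1) ^+ 2)) ->
  splittingFieldFor 1%VS (map_poly (in_alg E) (Lpoly M m)) fullv ->
  exists B : E -> E -> F,
    invariant_symplectic_form (Lpoly M m) B /\
    exists mu : F, exists J : E -> Prop,
      [/\ prime_ideal_R J, lies_over J mu &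
        exists s : gal_of {:E}, frobenius_at J s /\
          exists k : nat, transvection_on (Lpoly M m) (s ^+ k)%g].
Proof.
move=> m_gt0 szM [_ [_ recM]] M0 dM2 _ nM1 _ sqfM1 splitL.
have symM j : (j <= 2 * m)%N -> M`_j = M`_(2 * m - j).
  by move=> lej; rewrite recM szM //= M0 invr1 mul1r.
have MT : M`_(2 * m) = 1 by rewrite symM // subnn.
have [galE [vs [Uvs szvs Vvs gen_vs]]] := Lpoly_roots m_gt0 szM M0 MT splitL.
have [B symB] := exists_invariant_form m_gt0 szM symM MT Uvs szvs Vvs.
have [J primeJ J0] := @exists_prime_over F E.
have pJ := prime_ideal_R_prime_in primeJ.
have JR z : J z -> z \in integral_pred E by move=> Jz; apply/integral_predP/primeJ.1.
(* The roots of [L] serve as generators: they are integral, permuted by the Galois group and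
   distinct modulo [J]. *)
have [|||s frob_s] := exists_frobenius pJ JR J0 galE gen_vs.
- by move=> v /Vvs; apply: rootsV_integral.
- by move=> g v /Vvs Vv; apply/Vvs/rootsV_gal.
- by move=> u v /Vvs Vu /Vvs Vv; apply: (rootsV_mod_inj m_gt0 szM M0 MT pJ).
exists B; split=> //; exists 0, J; split=> //; exists s; split=> //.
have Js : {in integral_pred E, forall z, J (s z - frobE E z)}.
  by move=> z /integral_predP; apply: frob_s.2.2.
exact: (frobenius_pow_transvection m_gt0 szM M0 MT pJ J0 JR Js Uvs szvs Vvs).
Qed.
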